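(* Let $\Pi$, $Q$ be probability distributions on $\mathbb{R}^d$ with Lebesgue densities $\pi$, $q$ having support $\Theta$, let $P$ be the Metropolis-Hastings independence kernel with target $\Pi$ and proposal $Q$, let $\rho$ be a lower semicontinuous metric, and let $\mathcal{W}_\rho$ be the associated Wasserstein distance (all as in the context). Let $\epsilon^* = \inf_{\theta \in \Theta} \{ q(\theta)/\pi(\theta) \}$. Suppose $\rho(\cdot,\cdot) \le 1$. Then for every integer $t \ge 1$, $$\sup_{\theta \in \Theta} \mathcal{W}_\rho(P^t(\theta, \cdot), \Pi) \le (1 - \epsilon^* )^t \sup_{\theta \in \Theta} \int \rho(\omega, \theta)\, d\Pi(\omega).$$ If in addition $q$ is lower semicontinuous on $\Theta$, $\pi$ is upper semicontinuous on $\Theta$, and $\Theta$ can be expressed as a countable union of compact sets, then for every integer $t\ge 1$, $$(1 - \epsilon^* )^t \inf_{\theta \in \Theta} \int \rho(\omega, \theta)\, d\Pi(\omega) \le \sup_{\theta \in \Theta} \mathcal{W}_\rho(P^t(\theta, \cdot), \Pi) \le (1 - \epsilon^* )^t \sup_{\theta \in \Theta} \int \rho(\omega, \theta)\, d\Pi(\omega).$$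
   Context: Setting: $\Theta \subseteq \mathbb{R}^d$ is a nonempty measurable set. $\Pi$ (target) and $Q$ (proposal) are probability distributions on $\mathbb{R}^d$ with $Q \ne \Pi$, with Lebesgue densities $\pi$ and $q$ respectively, both with support $\Theta$, meaning that $\pi$ and $q$ are strictly positive on $\Theta$ and zero outside $\Theta$. Metropolis-Hastings independence (MHI) kernel: define $a(\theta,\theta') = \min\left\{ \frac{\pi(\theta') q(\theta)}{\pi(\theta) q(\theta')}, 1\right\}$ if $\pi(\theta) q(\theta') > 0$ and $a(\theta,\theta') = 1$ if $\pi(\theta) q(\theta') = 0$. For $\theta \in \mathbb{R}^d$ and measurable $B \subseteq \mathbb{R}^d$, $$P(\theta, B) = \int_B a(\theta,\theta') q(\theta')\, d\theta' + \delta_\theta(B)\left(1 - \int a(\theta,\theta') q(\theta')\, d\theta'\right),$$ where $\delta_\theta$ is the Dirac measure at $\theta$; $P^1 = P$ and $P^t(\theta,B) = \int P(\theta, d\theta') P^{t-1}(\theta', B)$ for $t \ge 2$. Wasserstein distance: for a lower semicontinuous metric $\rho$ on $\mathbb{R}^d$ (i.e. a metric that is lower semicontinuous as a function on $\mathbb{R}^d\times\mathbb{R}^d$ with the Euclidean topology) and probability measures $\mu,\nu$, $\mathcal{W}_\rho(\mu,\nu) = \inf_{\xi \in \mathcal{C}(\mu,\nu)} \int \rho(\theta,\omega)\, d\xi(\theta,\omega)$, where $\mathcal{C}(\mu,\nu)$ is the set of joint probability measures with marginals $\mu$ and $\nu$. *)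

(* Defs.v *)
From HB Require Import structures.
From mathcomp Require Import all_boot all_order all_algebra.
From mathcomp Require Import all_classical all_reals all_analysis.
Set Implicit Arguments.
Unset Strict Implicit.
Unset Printing Implicit Defensive.
Import Order.TTheory GRing.Theory Num.Theory.
Import numFieldNormedType.Exports.
Local Open Scope classical_set_scope.
Local Open Scope ring_scope.

(* Matrices, hence the row vectors 'rV[R]_n standing for R^n, carry the Borel
   sigma-algebra of their (product, i.e. Euclidean) topology. *)
Section borel.
Context (R : realType) (m n : nat).
Let opens : set (set 'M[R]_(m, n)) := [set U | open U].
HB.instance Definition _ := @isMeasurable.Build default_measure_display
  'M[R]_(m, n) <<s opens >>
  (@sigma_algebra0 _ setT opens) (@sigma_algebraC _ opens)
  (@sigma_algebra_bigcup _ setT opens).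
End borel.

Section row_cons.
Context (R : realType) (n : nat).

Lemma measurable_fun_row d (T : measurableType d) (f : T -> 'rV[R]_n) :
  (forall i, measurable_fun [set: T] (fun x => f x ord0 i)) ->
  measurable_fun [set: T] f.
Proof.
move=> mf.
apply: (@measurability _ _ _ _ setT f [set U | open U]) => //.
move=> _ [U oU <-]; rewrite setTI.
pose B (p : {ffun 'I_n -> rat} * {ffun 'I_n -> rat}) : set 'rV[R]_n :=
  [set v | forall i, ratr (p.1 i) < v ord0 i < ratr (p.2 i)].
have -> : f @^-1` U = \bigcup_(p in [set p | B p `<=` U]) (f @^-1` B p).
  apply/seteqP; split=> [x Ux|x [p BU]]; last exact: BU.
  have : nbhs (f x) U by apply: open_nbhs_nbhs.
  move=> /nbhs_ballP[e /= e0 eU].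
  have lo i : {q : rat | f x ord0 i - e < ratr q < f x ord0 i}.
    have h : f x ord0 i - e < f x ord0 i by rewrite ltrBlDr ltrDl.
    by apply: cid; have [q] := rat_in_itvoo h; rewrite in_itv/=; exists q.
  have hi i : {q : rat | f x ord0 i < ratr q < f x ord0 i + e}.
    have h : f x ord0 i < f x ord0 i + e by rewrite ltrDl.
    by apply: cid; have [q] := rat_in_itvoo h; rewrite in_itv/=; exists q.
  exists ([ffun i => sval (lo i)], [ffun i => sval (hi i)]) => /=; last first.
    move=> i /=; rewrite !ffunE; case: (lo i) => q /= /andP[_ ->].
    by case: (hi i) => r /= /andP[-> _].
  move=> v Bv; apply: eU; split => // i j; rewrite (ord1 i).
  move: (Bv j) => /=; rewrite !ffunE.
  case: (lo j) => q /= /andP[lq _]; case: (hi j) => r /= /andP[_ rh].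
  move=> /andP[qv vr]; rewrite /ball/= ltr_norml.
  apply/andP; split.
    by rewrite ltrBrDr addrC ltrBlDr (lt_trans vr)// addrC.
  by rewrite ltrBlDr -ltrBlDl (lt_trans lq).
rewrite bigcup_mkcond; apply: countable_bigcupT_measurable => [|p]; first exact: countableP.
case: ifPn => // _.
have -> : f @^-1` B p =
    \bigcap_(i in [set: 'I_n])
      ((fun x => f x ord0 i) @^-1` `]ratr (p.1 i), ratr (p.2 i)[).
  apply/seteqP; split=> [x Bx i _|x Bx i] /=; first by rewrite in_itv/=; exact: Bx.
  by have /= := Bx i Logic.I; rewrite in_itv.
apply: fin_bigcap_measurable => // i _.
by rewrite -[X in measurable X]setTI; apply: mf.
Qed.

Lemma measurable_coord (i : 'I_n) :
  measurable_fun [set: 'rV[R]_n] (fun v : 'rV[R]_n => v ord0 i).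
Proof.
apply: (measurability _ (measurable_realfun.RGenOpens.measurableE R)).
move=> _ [_ [a [b ->]] <-]; rewrite setTI; apply: sub_sigma_algebra => /=.
apply: open_comp; last exact: interval_open.
by move=> v _; exact: coord_continuous.
Qed.

Definition row_cons (z : R * 'rV[R]_n) : 'rV[R]_n.+1 :=
  \row_i (if unlift ord0 i is Some j then z.2 ord0 j else z.1).

Definition row_uncons (v : 'rV[R]_n.+1) : R * 'rV[R]_n :=
  (v ord0 ord0, \row_i v ord0 (lift ord0 i)).

Lemma row_consK : cancel row_cons row_uncons.
Proof.
move=> [x v]; rewrite /row_uncons /row_cons !mxE unlift_none/=; congr pair.
by apply/rowP => i; rewrite !mxE liftK.
Qed.

End row_cons.

Lemma measurable_row_cons (R : realType) n :
  measurable_fun [set: R * 'rV[R]_n] (@row_cons R n).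
Proof.
apply: measurable_fun_row => i.
under eq_fun do rewrite mxE.
case: unliftP => [j _|_]; last exact: measurable_fst.
exact: (measurableT_comp (measurable_coord j) measurable_snd).
Qed.

Lemma measurable_row_uncons (R : realType) n :
  measurable_fun [set: 'rV[R]_n.+1] (@row_uncons R n).
Proof.
apply: measurable_fun_pair; first exact: measurable_coord.
apply: measurable_fun_row => i.
under eq_fun do rewrite mxE.
exact: measurable_coord.
Qed.

Section lebesgue_row.
Context (R : realType).

Section step.
Context (n : nat) (mu : {sigma_finite_measure set 'rV[R]_n -> \bar R}).

Definition lebesgue_rowS : set 'rV[R]_n.+1 -> \bar R :=
  pushforward (@lebesgue_measure R \x mu)%E (@row_cons R n).

Let mrow_cons :
  measurable_fun [set: measurableTypeR R * 'rV[R]_n] (@row_cons R n).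
Proof. exact: measurable_row_cons. Qed.

Let pushed : {measure set 'rV[R]_n.+1 -> \bar R} :=
  measure_function_pushforward__canonical__measure_function_Measure
    (@lebesgue_measure R \x mu)%E mrow_cons.

HB.instance Definition _ := isMeasure.Build _ _ _ lebesgue_rowS
  (measure0 pushed) (measure_ge0 pushed)
  (@measure_semi_sigma_additive _ _ _ pushed).

Let lebesgue_rowS_sigma_finite : sigma_finite setT lebesgue_rowS.
Proof.
have /sigma_finiteP[F [TF ndF Foo]] := sigma_finiteT (@lebesgue_measure R).
have /sigma_finiteP[G [TG ndG Goo]] := sigma_finiteT mu.
exists (fun k => @row_uncons R n @^-1` (F k `*` G k)).
  apply/esym; rewrite -subTset => v _.
  have [i _ Fi] : (\bigcup_i F i) (row_uncons v).1 by rewrite -TF.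
  have [j _ Gj] : (\bigcup_i G i) (row_uncons v).2 by rewrite -TG.
  exists (maxn i j) => //; split => /=.
    by apply: subsetPset Fi; apply: ndF; exact: leq_maxl.
  by apply: subsetPset Gj; apply: ndG; exact: leq_maxr.
move=> k; have [mF Fk] := Foo k; have [mG Gk] := Goo k; split.
  rewrite -[X in measurable X]setTI; apply: measurable_row_uncons => //.
  exact: measurableX.
rewrite /lebesgue_rowS /pushforward -comp_preimage.
rewrite (_ : _ \o _ = id); last by apply/funext => z /=; rewrite row_consK.
by rewrite preimage_id product_measure1E// lte_mul_pinfty// ge0_fin_numE.
Qed.

HB.instance Definition _ :=
  Measure_isSigmaFinite.Build _ _ _ lebesgue_rowS lebesgue_rowS_sigma_finite.

End step.

(* Lebesgue measure on R^n as an iterated product, R^n.+1 being identified with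
   R * R^n by row_cons; lebesgue_row_box gives its value on boxes. *)
Fixpoint lebesgue_row n : {sigma_finite_measure set 'rV[R]_n -> \bar R} :=
  if n is n'.+1 then lebesgue_rowS (lebesgue_row n') else \d_(0 : 'rV[R]_0).

Lemma lebesgue_row_box n (A : 'I_n -> set R) :
  (forall i, measurable (A i)) ->
  lebesgue_row n [set v | forall i, A i (v ord0 i)] =
  (\prod_(i < n) lebesgue_measure (A i))%E.
Proof.
elim: n A => [|n IH] A mA.
  by rewrite big_ord0 /= diracE mem_set// => -[].
rewrite big_ord_recl /= /lebesgue_rowS /pushforward.
pose B : set 'rV[R]_n := [set v | forall i, A (lift ord0 i) (v ord0 i)].
have mB : measurable B.
  rewrite (_ : B = \bigcap_(i in [set: 'I_n])
      ((fun v : 'rV[R]_n => v ord0 i) @^-1` A (lift ord0 i))).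
    apply: fin_bigcap_measurable => // i _.
    by rewrite -[X in measurable X]setTI; apply: measurable_coord.
  by apply/seteqP; split=> v Av i => [_|]; apply: Av.
have -> : @row_cons R n @^-1` [set v | forall i, A i (v ord0 i)] =
    A ord0 `*` B.
  apply/seteqP; split=> [[x v] /= Av|[x v] /= [Ax Av] i].
    split; first by have := Av ord0; rewrite mxE unlift_none.
    by move=> i; have := Av (lift ord0 i); rewrite mxE liftK.
  by rewrite mxE; case: unliftP => [j|] ->; [exact: Av|exact: Ax].
have -> : (@lebesgue_measure R \x lebesgue_row n)%E (A ord0 `*` B) =
    (lebesgue_measure (A ord0) * lebesgue_row n B)%E.
  exact: (@product_measure1E _ _ (measurableTypeR R) _ R
    lebesgue_measure (lebesgue_row n) (A ord0) B (mA ord0) mB).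
congr (_ * _)%E.
exact: (IH (fun i => A (lift ord0 i))).
Qed.

End lebesgue_row.

Definition upper_semicontinuous (X : topologicalType) (R : numFieldType)
    (f : X -> \bar R) :=
  forall x a, (f x < a%:E)%E ->
    exists2 V, nbhs x V & forall y, V y -> (f y < a%:E)%E.

Record is_metric (T : Type) (R : numDomainType) (rho : T -> T -> R) : Prop := {
  is_metric_ge0 : forall x y, 0 <= rho x y;
  is_metric_eq0 : forall x y, rho x y = 0 <-> x = y;
  is_metric_sym : forall x y, rho x y = rho y x;
  is_metric_triangle : forall x y z, rho x z <= rho x y + rho y z
}.

Section wasserstein.
Context d (T : measurableType d) (R : realType).
Implicit Types mu nu : set T -> \bar R.

Definition couplings mu nu : set (probability (T * T)%type R) :=
  [set xi | forall A, measurable A ->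
    xi (A `*` setT) = mu A /\ xi (setT `*` A) = nu A].

Definition wasserstein (rho : T -> T -> R) mu nu : \bar R :=
  ereal_inf [set (\int[xi]_z (rho z.1 z.2)%:E)%E | xi in couplings mu nu].

End wasserstein.

(* Kernels are plain set functions on which no measure structure is imposed: the
   library's integral is defined for any [set T -> \bar R]. *)
Section kernel_iter.
Context d (T : measurableType d) (R : realType).

(* The value at t = 0 is only a convention; P^1 is P itself. *)
Fixpoint kernel_iter (P : T -> set T -> \bar R) (t : nat) (x : T) (B : set T)
    : \bar R :=
  match t with
  | 0 => \d_x B
  | 1 => P x B
  | t'.+1 => (\int[P x]_y kernel_iter P t' y B)%E
  end.

End kernel_iter.

Section mhi.
Context (R : realType) (d : nat).
Implicit Types (f pi q : 'rV[R]_d -> R) (Theta : set 'rV[R]_d).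

Definition has_density (P : probability 'rV[R]_d R) f :=
  measurable_fun [set: 'rV[R]_d] f /\
  forall A, measurable A -> P A = (\int[lebesgue_row R d]_(x in A) (f x)%:E)%E.

Definition has_support f Theta :=
  (forall x, Theta x -> 0 < f x) /\ (forall x, ~ Theta x -> f x = 0).

Definition mhi_accept pi q (x y : 'rV[R]_d) : R :=
  if 0 < pi x * q y then Num.min (pi y * q x / (pi x * q y)) 1 else 1.

Definition mhi_kernel pi q (x : 'rV[R]_d) (B : set 'rV[R]_d) : \bar R :=
  (\int[lebesgue_row R d]_(y in B) (mhi_accept pi q x y * q y)%:E +
   \d_x B *
     (1 - \int[lebesgue_row R d]_y (mhi_accept pi q x y * q y)%:E))%E.

End mhi.

(* Main.v *)
(* Write h(x, y) = a(x, y) q(y), so that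
   P(x, dy) = h(x, y) dy + (1 - A(x)) delta_x(dy), A(x) the integral of h(x, .).
   For x in Theta, h(x, y) = min(r(x) pi(y), q(y)) with r = q / pi.

   Upper bound: eps pi <= h on Theta, and Pi is invariant by detailed balance,
   so P^t(x, .) = (1 - (1 - eps)^t) Pi + N^t(x, .), where N is P with h replaced
   by its excess (h - eps pi)^+. Couple the Pi part with Pi on the diagonal and
   the remainder N^t(x, .), of mass (1 - eps)^t, independently.

   Lower bound: test the transport cost against the 1-Lipschitz function
   f = rho(., x). Since f(x) = 0, h <= r(x) pi and 1 - A <= 1 - eps, one gets
   P^t f(x) <= r(x) (sum_(k < t) (1 - eps)^k) Pi f, whence
   W(P^t(x, .), Pi) >= ((1 - eps)^t - (r(x) - eps) t) Pi f; let r(x) tend to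
   eps, which need not be attained. *)
Require Import Defs.
From HB Require Import structures.
From mathcomp Require Import all_boot all_order all_algebra.
From mathcomp Require Import all_classical all_reals all_analysis.
From mathcomp Require Import measurable_realfun.
From mathcomp Require Import ring lra.
Set Implicit Arguments.
Unset Strict Implicit.
Unset Printing Implicit Defensive.
Import Order.TTheory GRing.Theory Num.Theory.
Import numFieldNormedType.Exports.
Local Open Scope classical_set_scope.
Local Open Scope ring_scope.

(** * Integration against a measure given by a density *)

Section density.
Local Open Scope ereal_scope.
Context d (T : measurableType d) (R : realType).
Import HBNNSimple.

(** The hypothesis on [nu] is the case of indicators; linearity extends it to simple functions, and
    monotone convergence to all nonnegative [f]. *)
Lemma ge0_integral_density (mu nu : {measure set T -> \bar R})
    (g : T -> R) (f : T -> \bar R) :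
  measurable_fun setT g -> (forall x, (0 <= g x)%R) ->
  (forall A, measurable A -> nu A = \int[mu]_(x in A) (g x)%:E) ->
  measurable_fun setT f -> (forall x, 0 <= f x) ->
  \int[nu]_x f x = \int[mu]_x (f x * (g x)%:E).
Proof.
move=> mg g0 nuE mf f0.
have mgE : measurable_fun setT (EFin \o g) by exact/measurable_EFinP.
pose f_ := nnsfun_approx measurableT mf.
have f_nd x : {homo (fun n => (f_ n x)%:E) : m n / (m <= n)%N >-> m <= n}.
  by move=> a b ab; rewrite lee_fin; exact/lefP/nd_nnsfun_approx.
have f_cvg x : (f_ n x)%:E @[n --> \oo] --> f x by exact: cvg_nnsfun_approx.
have mf_ n : measurable_fun setT (fun x => (f_ n x)%:E).
  exact/measurable_EFinP.
have mf_g n : measurable_fun setT (fun x => (f_ n x)%:E * (g x)%:E).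
  exact: emeasurable_funM (mf_ n) mgE.
have indicE A : measurable A ->
    \int[nu]_x (\1_A x)%:E = \int[mu]_x ((\1_A x)%:E * (g x)%:E).
  move=> mA; rewrite integral_indic// setIT nuE// integral_mkcond.
  by apply: eq_integral => x _; rewrite patchE indicE;
    case: ifPn => _; rewrite ?mul1e ?mul0e.
have sfunE n : \int[nu]_x (f_ n x)%:E = \int[mu]_x ((f_ n x)%:E * (g x)%:E).
  under eq_integral do rewrite fimfunE -fsumEFin//.
  rewrite ge0_integral_fsum//; last 2 first.
    - by move=> r; exact/measurable_EFinP/measurableT_comp.
    - by move=> r z _; rewrite EFinM nnfun_muleindic_ge0.
  under [RHS]eq_integral.
    move=> x _; rewrite fimfunE -fsumEFin// ge0_mule_fsuml; last first.
      by move=> r; rewrite EFinM nnfun_muleindic_ge0.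
    over.
  rewrite /= ge0_integral_fsum//; last 2 first.
    - move=> r; apply: emeasurable_funM mgE.
      by apply/measurable_EFinP; exact: measurable_funM.
    - move=> r z _; apply: mule_ge0; last by rewrite lee_fin.
      by rewrite EFinM nnfun_muleindic_ge0.
  apply: eq_fsbigr => r _.
  (* A negative [r] is not a value of the nonnegative [f_ n], so both of its terms vanish; a
     nonnegative [r] can be pulled out of the integrals. *)
  have [r0|r0] := leP 0%R r; last first.
    rewrite !integral0_eq// => x _; rewrite preimage_nnfun0// indic0 mulr0//.
    by rewrite mul0e.
  under eq_integral do rewrite EFinM.
  rewrite ge0_integralZl//; last exact/measurable_EFinP.
  rewrite indicE//.
  under [RHS]eq_integral do rewrite EFinM -muleA.
  rewrite ge0_integralZl//.
  - by apply: emeasurable_funM mgE; exact/measurable_EFinP.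
  - by move=> x _; rewrite mule_ge0// lee_fin.
transitivity (\int[nu]_x limn (fun n => (f_ n x)%:E)).
  by apply: eq_integral => x _; apply/esym/cvg_lim.
rewrite monotone_convergence//; last by move=> n x _; rewrite lee_fin.
under eq_fun do rewrite sfunE.
rewrite -monotone_convergence//; last 2 first.
- by move=> n x _; rewrite mule_ge0// lee_fin.
- by move=> x _ a b ab; rewrite lee_wpmul2r ?lee_fin// -lee_fin f_nd.
apply: eq_integral => x _; apply/cvg_lim => //.
by under eq_fun do rewrite muleC; rewrite muleC; exact: cvgeZl.
Qed.

End density.

Section mdensity.
Local Open Scope ereal_scope.
Context d (T : measurableType d) (R : realType).
Variables (mu : {measure set T -> \bar R}) (g : T -> R).

(* The side conditions are arguments so that the measure instance below can be
   inferred from the constant alone. *)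
Definition mdensity of (forall x, (0 <= g x)%R) & measurable_fun setT g :
  set T -> \bar R := fun A => \int[mu]_(x in A) (g x)%:E.

Hypothesis g0 : forall x, (0 <= g x)%R.
Hypothesis mg : measurable_fun setT g.
Local Notation nu := (mdensity g0 mg).

Let nu0 : nu set0 = 0.
Proof. exact: integral_set0. Qed.

Let nu_ge0 B : 0 <= nu B.
Proof. by apply: integral_ge0 => y _; rewrite lee_fin. Qed.

Let nu_sigma_additive : semi_sigma_additive nu.
Proof.
have mgE : measurable_fun setT (EFin \o g) by exact/measurable_EFinP.
exact: (@semi_sigma_additive_nng_induced _ _ _ mu _ mgE).
Qed.

HB.instance Definition _ :=
  isMeasure.Build _ _ _ nu nu0 nu_ge0 nu_sigma_additive.

End mdensity.

(** * Sub-Markov kernels with a jump density and an atom at the current state *)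

Section jump_kernel.
Local Open Scope ereal_scope.
Context d (T : measurableType d) (R : realType).
Variable mu : {sigma_finite_measure set T -> \bar R}.
Variables (h : T -> T -> R) (b : T -> \bar R).

(** The atom weight [b] is a free parameter, so that one construction serves both the sampler and
    the kernel of smaller mass that remains once a multiple of the target is split off. *)
Definition jump (x : T) (B : set T) : \bar R :=
  \int[mu]_(y in B) (h x y)%:E + \d_x B * b x.

Hypothesis h0 : forall x y, (0 <= h x y)%R.
Hypothesis mh : measurable_fun setT (fun z : T * T => h z.1 z.2).
Hypothesis b0 : forall x, 0 <= b x.
Hypothesis mb : measurable_fun setT b.
Hypothesis jump_le1 : forall x, \int[mu]_y (h x y)%:E + b x <= 1.

Let mhx x : measurable_fun setT (h x).
Proof. exact: (measurableT_comp mh (pair1_measurable x)). Qed.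

Let b_fin x : b x \is a fin_num.
Proof.
rewrite ge0_fin_numE// (le_lt_trans _ (ltry 1))// (le_trans _ (jump_le1 x))//.
by rewrite leeDr// integral_ge0// => y _; rewrite lee_fin.
Qed.

(** Scaling a measure takes a nonnegative real, hence [fine]; nothing is lost, because [jump_le1]
    makes [b x] finite. *)
Definition jump_measure (x : T) : {measure set T -> \bar R} :=
  measure_add (mdensity mu (h0 x) (mhx x))
    (mscale (NngNum (fine_ge0 (b0 x))) \d_x).

Let jump_measureE x : (jump_measure x : set T -> \bar R) = jump x.
Proof.
apply/funext => B; rewrite /jump_measure [LHS]measure_addE; congr (_ + _).
transitivity ((fine (b x))%:E * \d_x B); first by [].
by rewrite fineK// muleC.
Qed.

Let measurable_jump U : measurable U -> measurable_fun setT (jump_measure ^~ U).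
Proof.
move=> mU; under eq_fun do rewrite jump_measureE.
apply: emeasurable_funD; last first.
  apply: emeasurable_funM => //; apply/measurable_EFinP.
  exact: measurable_indic.
(* With the restriction to [U] moved into the integrand, this is a partial integral of a jointly
   measurable function. *)
under eq_fun do rewrite integral_mkcond.
apply: (measurable_fun_fubini_tonelli_F (m2 := mu)
  (fun z : T * T => ((fun y => (h z.1 y)%:E) \_ U) z.2)).
  rewrite (_ : (fun _ => _) =
    (fun z : T * T => (h z.1 z.2)%:E * (\1_U z.2)%:E)); last first.
    apply/funext => z; rewrite patchE indicE.
    by case: ifPn => _; rewrite ?mule1 ?mule0.
  apply: emeasurable_funM; apply/measurable_EFinP => //.
  exact: measurableT_comp.
by move=> z; rewrite patchE; case: ifPn; rewrite ?lee_fin.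
Qed.

HB.instance Definition _ :=
  isKernel.Build _ _ T T R jump_measure measurable_jump.

Let jump_setT : ereal_sup [set jump_measure x setT | x in setT] <= 1.
Proof.
apply: (sprob_kernelP (fun x A => jump_measure x A)).2 => x.
by rewrite jump_measureE /jump diracT mul1e.
Qed.

HB.instance Definition _ :=
  Kernel_isSubProbability.Build _ _ T T R jump_measure jump_setT.

(** Forgets the construction: from here on a kernel is known through its values on sets. *)
Lemma jump_kernel :
  exists K : R.-spker T ~> T, forall x, (K x : set T -> \bar R) = jump x.
Proof. by exists jump_measure. Qed.

Lemma ge0_integral_jump (f : T -> \bar R) x :
  measurable_fun setT f -> (forall y, 0 <= f y) ->
  \int[jump x]_y f y = \int[mu]_y (f y * (h x y)%:E) + f x * b x.
Proof.
move=> mf f0; rewrite -jump_measureE /jump_measure ge0_integral_measure_add//.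
rewrite (@ge0_integral_density _ _ _ mu _ (h x))//.
rewrite ge0_integral_mscale// integral_dirac// diracT mul1e/= fineK//.
by rewrite muleC.
Qed.

End jump_kernel.

(** * Iterates of a sub-probability kernel *)

Section kernel_power.
Local Open Scope ereal_scope.
Context d (T : measurableType d) (R : realType).

Fixpoint kpow (K : R.-spker T ~> T) (t : nat) : R.-spker T ~> T :=
  if t is t'.+1 then mkcomp_noparam K (kpow K t')
  else kdirac (@measurable_id _ T setT).

Lemma integral_kpow0 K (f : T -> \bar R) x : measurable_fun setT f ->
  \int[kpow K 0 x]_y f y = f x.
Proof. by move=> mf; rewrite integral_dirac// diracT mul1e. Qed.

Lemma ge0_integral_kpowS K t (f : T -> \bar R) x :
  measurable_fun setT f -> (forall y, 0 <= f y) ->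
  \int[kpow K t.+1 x]_z f z = \int[K x]_y \int[kpow K t y]_z f z.
Proof.
by move=> mf f0; exact: (integral_kcomp K (kernel.kernel_snd (kpow K t))).
Qed.

Lemma measurable_integral_kpow K t (f : T -> \bar R) :
  measurable_fun setT f -> (forall y, 0 <= f y) ->
  measurable_fun setT (fun x => \int[kpow K t x]_y f y).
Proof.
by move=> mf f0; apply: measurable_fun_integral_kernel => // U mU;
  exact: measurable_kernel.
Qed.

Lemma kernel_iterE (P : T -> set T -> \bar R) (K : R.-spker T ~> T) t x B :
  (forall x, K x = P x :> (set T -> \bar R)) -> measurable B ->
  kernel_iter P t x B = kpow K t x B.
Proof.
move=> KP mB; elim: t x => [//|[|t] IH] x.
  (* At exponent 1, [kernel_iter] is [P] itself while [kpow] composes [K] with the Dirac kernel; the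
     integral of an indicator reconciles the two. *)
  rewrite /= /mkcomp_noparam /kcomp_noparam -KP.
  transitivity (\int[K x]_y (\1_B y)%:E); last exact: eq_integral.
  by rewrite integral_indic// setIT.
transitivity (\int[K x]_y kernel_iter P t.+1 y B); first by rewrite KP.
by apply: eq_integral => y _; exact: IH.
Qed.

End kernel_power.

(** * Borel measurability of lower semicontinuous functions *)

Lemma lower_semicontinuous_measurable_row (R : realType) n
    (f : 'rV[R]_n -> \bar R) :
  lower_semicontinuous f -> measurable_fun [set: 'rV[R]_n] f.
Proof.
move=> /lower_semicontinuousP lf.
apply: (measurability _ (ErealGenOInfty.measurableE R)) => _ /= [_ [a ->]] <-.
rewrite setTI; apply: sub_sigma_algebra => /=.
by rewrite preimage_itvoy; exact: lf.
Qed.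

Lemma lower_semicontinuous_comp (X Y : topologicalType) (R : numFieldType)
    (f : Y -> \bar R) (g : X -> Y) :
  continuous g -> lower_semicontinuous f -> lower_semicontinuous (f \o g).
Proof.
by move=> cg lf x a /lf[V gxV Vf]; exists (g @^-1` V) => [|y /Vf//]; exact: cg.
Qed.

(* [row_mx] identifies R^n * R^n with R^(n + n); this avoids comparing the Borel
   sigma-algebra of the product topology with the product sigma-algebra. *)
Lemma lower_semicontinuous_measurable_row2 (R : realType) n
    (f : 'rV[R]_n * 'rV[R]_n -> \bar R) :
  lower_semicontinuous f -> measurable_fun [set: 'rV[R]_n * 'rV[R]_n] f.
Proof.
move=> lf; pose split (w : 'rV[R]_(n + n)) := (lsubmx w, rsubmx w).
have -> : f = (f \o split) \o (fun z => row_mx z.1 z.2).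
  by apply/funext => -[x y] /=; rewrite /split row_mxKl row_mxKr.
apply: measurableT_comp.
  apply: lower_semicontinuous_measurable_row.
  apply: lower_semicontinuous_comp lf => w.
  exact: (@cvg_pair _ _ _ (nbhs w) _ _ _ _ _ _ _
    (@continuous_lsubmx R 1 n n w) (@continuous_rsubmx R 1 n n w)).
apply: measurable_fun_row => i; under eq_fun do rewrite mxE.
case: (fintype.split i) => j.
  exact: (measurableT_comp (measurable_coord j) measurable_fst).
exact: (measurableT_comp (measurable_coord j) measurable_snd).
Qed.

(** * Bundling measures as probabilities or as finite measures *)

Section measure_probability.
Context d (T : measurableType d) (R : realType).
Variable mu : {measure set T -> \bar R}.

Definition probability_of_measure of mu setT = 1%E : set T -> \bar R := mu.

Hypothesis mu1 : mu setT = 1%E.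

HB.instance Definition _ := Measure.on (probability_of_measure mu1).
HB.instance Definition _ :=
  Measure_isProbability.Build _ _ _ (probability_of_measure mu1) mu1.

End measure_probability.

Section measure_finite.
Context d (T : measurableType d) (R : realType).
Variable mu : {measure set T -> \bar R}.

Definition finite_of_measure of fin_num_fun mu : set T -> \bar R := mu.

Hypothesis mu_fin : fin_num_fun mu.

HB.instance Definition _ := Measure.on (finite_of_measure mu_fin).
HB.instance Definition _ :=
  Measure_isFinite.Build _ _ _ (finite_of_measure mu_fin) mu_fin.

End measure_finite.

(** * Upper and lower bounds on transport costs *)

Section wasserstein_bounds.
Local Open Scope ereal_scope.
Context d (T : measurableType d) (R : realType).
Variable rho : T -> T -> R.
Hypothesis rho0 : forall x y, (0 <= rho x y)%R.
Hypothesis mrho :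
  measurable_fun [set: T * T] (fun z : T * T => (rho z.1 z.2)%:E).

(** The common part [c nu] is transported along the diagonal at no cost. The product [M \x nu] is
    left unnormalised: its first marginal is already [M], and there is no division by the mass of
    [M], which may be zero. *)
Lemma wasserstein_le_mixture (mu : set T -> \bar R) (nu : probability T R)
    (M : {finite_measure set T -> \bar R}) (c : R) :
  (forall x, rho x x = 0%R) -> (0 <= c)%R ->
  (forall A, measurable A -> mu A = c%:E * nu A + M A) -> mu setT = 1 ->
  wasserstein rho mu nu <= \int[M]_x \int[nu]_y (rho x y)%:E.
Proof.
move=> rhoxx c0 muE mu1.
pose diag (x : T) := (x, x).
have mdiag : measurable_fun setT diag by exact: measurable_fun_pair.
pose nudiag : {measure set (T * T) -> \bar R} :=
  measure_function_pushforward__canonical__measure_function_Measure nu mdiag.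
pose xi : {measure set (T * T) -> \bar R} :=
  measure_add (mscale (NngNum c0) nudiag) (M \x nu).
have xiE A B : measurable A -> measurable B ->
    xi (A `*` B) = c%:E * nu (A `&` B) + M A * nu B.
  move=> mA mB; rewrite /xi [LHS]measure_addE; congr (_ + _).
  exact: product_measure1E.
(* This balance of masses makes the second marginal of [xi], which is [(c + M setT) nu], equal to
   [nu]. *)
have cM : c%:E + M setT = 1 by rewrite -mu1 muE// (probability_setT nu) mule1.
have xi1 : xi setT = 1.
  by rewrite -setXTT xiE// setIT (probability_setT nu) !mule1.
pose Xi : probability (T * T)%type R := probability_of_measure xi1.
have XiE : Xi = xi :> (set _ -> \bar R) by [].
apply: ereal_inf_lbound; exists Xi; last first.
  rewrite XiE /xi ge0_integral_measure_add//; last first.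
    by move=> z _; rewrite lee_fin.
  rewrite ge0_integral_mscale//; last by move=> z _; rewrite lee_fin.
  rewrite ge0_integral_pushforward//; last by move=> z _; rewrite lee_fin.
  rewrite preimage_setT integral0_eq ?mule0 ?add0e; last first.
    by move=> x _; rewrite /= rhoxx.
  by rewrite (@fubini_tonelli1 _ _ _ _ _ M nu)// => z; rewrite lee_fin rho0.
move=> A mA; rewrite XiE; split.
  by rewrite xiE// setIT (probability_setT nu) mule1 muE.
rewrite xiE// setTI -ge0_muleDl ?lee_fin//.
by rewrite cM mul1e.
Qed.

(* Easy half of Kantorovich duality, for the potential [rho ^~ o]. *)
Lemma wasserstein_ge_potential (mu : set T -> \bar R)
    (mu' : {measure set T -> \bar R}) (nu : probability T R) (o : T) (c : R) :
  (forall x y, rho x y = rho y x) ->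
  (forall x y z, (rho x z <= rho x y + rho y z)%R) ->
  (forall A, measurable A -> mu A = mu' A) ->
  \int[mu']_y (rho y o)%:E <= c%:E ->
  \int[nu]_y (rho y o)%:E - c%:E <= wasserstein rho mu nu.
Proof.
move=> rhoC rho_tri muE lec; apply: le_ereal_inf_tmp => _ [xi xiP <-].
have mo : measurable_fun setT (fun y => (rho y o)%:E).
  exact: (measurableT_comp mrho (pair2_measurable o)).
have marginal (p : T * T -> T) (m : {measure set T -> \bar R}) :
    measurable_fun setT p ->
    (forall A, measurable A -> xi (p @^-1` A) = m A) ->
    \int[m]_y (rho y o)%:E = \int[xi]_z (rho (p z) o)%:E.
  move=> mp mE.
  rewrite -(ge0_integral_pushforward mp xi measurableT mo)//; last first.
    by move=> y _; rewrite lee_fin.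
  apply: (eq_measure_integral
    (measure_function_pushforward__canonical__measure_function_Measure xi mp)).
  by move=> A mA _; rewrite -mE.
(* Both integrals of the potential are carried over to [xi], where the claim is the integrated
   triangle inequality through [z.1]. *)
rewrite leeBlDr//.
rewrite (marginal snd); [|exact: measurable_snd|]; last first.
  by move=> A mA; rewrite -setTX; exact: (xiP A mA).2.
rewrite (le_trans _ (leeD2l _ lec))//.
rewrite (marginal fst); [|exact: measurable_fst|]; last first.
  by move=> A mA; rewrite -setXT -muE//; exact: (xiP A mA).1.
have mo1 : measurable_fun setT (fun z : T * T => (rho z.1 o)%:E).
  exact: (measurableT_comp mo measurable_fst).
have rho0E x y : 0 <= (rho x y)%:E by rewrite lee_fin.
rewrite -ge0_integralD//.
apply: ge0_le_integral => //.
- exact: (measurableT_comp mo measurable_snd).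
- by apply: emeasurable_funD.
- by move=> z _; rewrite -EFinD lee_fin (rhoC z.1 z.2) rho_tri.
Qed.

End wasserstein_bounds.

(** * Invariance of the target under a reversible jump kernel *)

Section reversible_jump.
Local Open Scope ereal_scope.
Context d (T : measurableType d) (R : realType).
Variable mu : {sigma_finite_measure set T -> \bar R}.
Variables (h : T -> T -> R) (pi : T -> R) (Pi : probability T R).
Hypothesis h0 : forall x y, (0 <= h x y)%R.
Hypothesis mh : measurable_fun setT (fun z : T * T => h z.1 z.2).
Hypothesis h_le1 : forall x, \int[mu]_y (h x y)%:E <= 1.
Hypothesis pi0 : forall x, (0 <= pi x)%R.
Hypothesis mpi : measurable_fun setT pi.
Hypothesis PiE :
  forall A, measurable A -> Pi A = \int[mu]_(x in A) (pi x)%:E.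

Definition stay (x : T) : \bar R := 1 - \int[mu]_y (h x y)%:E.

Variable K : R.-spker T ~> T.
Hypothesis KE : forall x, K x = jump mu h stay x :> (set T -> \bar R).

Let h0E x y : 0 <= (h x y)%:E. Proof. by rewrite lee_fin. Qed.

Let pi0E x : 0 <= (pi x)%:E. Proof. by rewrite lee_fin. Qed.

Let mpiE : measurable_fun setT (fun x => (pi x)%:E).
Proof. exact/measurable_EFinP. Qed.

Let mhE x : measurable_fun setT (fun y => (h x y)%:E).
Proof.
by apply/measurable_EFinP; exact: (measurableT_comp mh (pair1_measurable x)).
Qed.

Let mhE2 : measurable_fun setT (fun z : T * T => (h z.1 z.2)%:E).
Proof. exact/measurable_EFinP. Qed.

Lemma stay_ge0 x : 0 <= stay x.
Proof. by rewrite /stay sube_ge0// orbT. Qed.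

Lemma integral_h_fin x : \int[mu]_y (h x y)%:E \is a fin_num.
Proof.
by rewrite ge0_fin_numE ?(le_lt_trans (h_le1 x)) ?ltry// integral_ge0.
Qed.

Lemma measurable_stay : measurable_fun setT stay.
Proof.
apply: emeasurable_funB => //.
exact: (measurable_fun_fubini_tonelli_F (m2 := mu)
  (fun z : T * T => (h z.1 z.2)%:E)).
Qed.

Lemma h_addstay x : \int[mu]_y (h x y)%:E + stay x = 1.
Proof. by rewrite /stay addeCA subee ?adde0// integral_h_fin. Qed.

Lemma integral_target (f : T -> \bar R) :
  measurable_fun setT f -> (forall x, 0 <= f x) ->
  \int[Pi]_x f x = \int[mu]_x (f x * (pi x)%:E).
Proof. by move=> mf f0; exact: ge0_integral_density. Qed.

Lemma integral_jump_stay (f : T -> \bar R) x :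
  measurable_fun setT f -> (forall y, 0 <= f y) ->
  \int[K x]_y f y = \int[mu]_y (f y * (h x y)%:E) + f x * stay x.
Proof.
move=> mf f0; rewrite KE; apply: ge0_integral_jump => //.
- exact: stay_ge0.
- by move=> y; rewrite h_addstay.
Qed.

Hypothesis reversible : forall x y, (pi x * h x y = pi y * h y x)%R.

(** Detailed balance turns the mass that jumps into [y] into the mass that jumps out of [y]; adding
    the mass that stays gives back [pi y]. *)
Lemma integral_invariant (f : T -> \bar R) :
  measurable_fun setT f -> (forall x, 0 <= f x) ->
  \int[Pi]_x \int[K x]_y f y = \int[Pi]_x f x.
Proof.
move=> mf f0; have mstay := measurable_stay; have stay0 := stay_ge0.
have mfh : measurable_fun setT (fun z : T * T => f z.2 * (h z.1 z.2)%:E).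
  by apply: emeasurable_funM => //; exact: measurableT_comp.
have mfhp : measurable_fun setT
    (fun z : T * T => f z.2 * ((pi z.1)%:E * (h z.1 z.2)%:E)).
  apply: emeasurable_funM; first exact: measurableT_comp.
  apply: emeasurable_funM => //.
  exact: (measurableT_comp mpiE measurable_fst).
have mF : measurable_fun setT (fun x => \int[mu]_y (f y * (h x y)%:E)).
  apply: (measurable_fun_fubini_tonelli_F (m2 := mu)
    (fun z : T * T => f z.2 * (h z.1 z.2)%:E)) => // z.
  by rewrite mule_ge0.
have mFK : measurable_fun setT (fun x => \int[K x]_y f y).
  by apply: measurable_fun_integral_kernel => // U; exact: measurable_kernel.
rewrite !integral_target//; last by move=> x; exact: integral_ge0.
under eq_integral.
  move=> x _; rewrite integral_jump_stay// ge0_muleDl; last 2 first.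
    by apply: integral_ge0 => y _; rewrite mule_ge0.
    by rewrite mule_ge0.
  rewrite -ge0_integralZr//; last 2 first.
    by apply: emeasurable_funM.
    by move=> y _; rewrite mule_ge0.
  under eq_integral do rewrite -muleA (muleC (h x _)%:E).
  over.
rewrite /= ge0_integralD//; last 4 first.
- by move=> x _; apply: integral_ge0 => y _; rewrite !mule_ge0.
- apply: (measurable_fun_fubini_tonelli_F (m2 := mu)
    (fun z : T * T => f z.2 * ((pi z.1)%:E * (h z.1 z.2)%:E))) => // z.
  by rewrite !mule_ge0.
- by move=> x _; rewrite !mule_ge0.
- by apply: emeasurable_funM => //; apply: emeasurable_funM.
(* After the exchange [y] is fixed and the starting point is integrated out, so [reversible] makes
   the inner integral that of [h y]. *)
rewrite (fubini_tonelli
  (fun z : T * T => f z.2 * ((pi z.1)%:E * (h z.1 z.2)%:E)))//=; last first.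
  by move=> z; rewrite !mule_ge0.
rewrite -ge0_integralD//; last 4 first.
- by move=> x _; apply: integral_ge0 => y _; rewrite !mule_ge0.
- apply: (measurable_fun_fubini_tonelli_G (m1 := mu)
    (fun z : T * T => f z.2 * ((pi z.1)%:E * (h z.1 z.2)%:E))) => // z.
  by rewrite !mule_ge0.
- by move=> x _; rewrite !mule_ge0.
- by apply: emeasurable_funM => //; apply: emeasurable_funM.
apply: eq_integral => y _.
under eq_integral do rewrite -EFinM reversible EFinM muleA.
rewrite ge0_integralZl//; last by rewrite mule_ge0.
rewrite (muleAC (f y) (stay y)).
by rewrite -ge0_muleDr ?integral_ge0// h_addstay mule1.
Qed.

Lemma kpow_invariant t (f : T -> \bar R) :
  measurable_fun setT f -> (forall x, 0 <= f x) ->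
  \int[Pi]_x \int[kpow K t x]_y f y = \int[Pi]_x f x.
Proof.
move=> mf f0; elim: t => [|t IH].
  by apply: eq_integral => x _; rewrite integral_kpow0.
rewrite -[RHS]IH -[RHS]integral_invariant//.
- by apply: eq_integral => x _; rewrite ge0_integral_kpowS.
- exact: measurable_integral_kpow.
- by move=> x; exact: integral_ge0.
Qed.

Let mass_target : \int[mu]_x (pi x)%:E = 1.
Proof. by rewrite -(PiE measurableT) probability_setT. Qed.

Lemma kpow_invariantE t B : measurable B ->
  \int[Pi]_x kpow K t x B = Pi B.
Proof.
move=> mB; transitivity (\int[Pi]_x \int[kpow K t x]_y (\1_B y)%:E).
  by apply: eq_integral => x _; rewrite integral_indic// setIT.
rewrite kpow_invariant; [|exact/measurable_EFinP|by move=> x; rewrite lee_fin].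
by rewrite integral_indic// setIT.
Qed.

(** The type of [K] only gives mass at most one; equality comes from [stay] being the exact
    complement of the jump mass. *)
Lemma kpow_setT t x : kpow K t x setT = 1.
Proof.
elim: t x => [|t IH] x; first exact: diracT.
rewrite /= /mkcomp_noparam /kcomp_noparam.
under eq_integral do rewrite IH.
by rewrite integral_cst// mul1e KE /jump diracT mul1e h_addstay.
Qed.

(** * Splitting off the target under a minorization *)

Section minorization.
Variables (Theta : set T) (eps : R).
Hypothesis eps0 : (0 <= eps)%R.
Hypothesis minorization : forall x y, Theta x -> (eps * pi y <= h x y)%R.
Hypothesis h_out : forall x y, ~ Theta y -> h x y = 0%R.

(** The truncation at 0 keeps this a density for every [x], since the minorization is assumed on
    [Theta] only; for [x] in [Theta] it is inactive, see [excessE]. *)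
Definition excess (x y : T) : R :=
  Num.max 0%R (h x y - eps * pi y)%R.

Lemma excess_ge0 x y : (0 <= excess x y)%R.
Proof. by rewrite /excess le_max lexx. Qed.

Lemma excess_le x y : (excess x y <= h x y)%R.
Proof. by rewrite /excess ge_max h0/= lerBlDr lerDl mulr_ge0. Qed.

Lemma measurable_excess : measurable_fun setT (fun z : T * T => excess z.1 z.2).
Proof.
apply: measurable_maxr => //; apply: measurable_funB => //.
by apply: measurable_funM => //; exact: (measurableT_comp mpi measurable_snd).
Qed.

Lemma excess_out x y : ~ Theta y -> excess x y = 0%R.
Proof.
move=> Ty; rewrite /excess h_out// sub0r; apply/max_idPl.
by rewrite oppr_le0 mulr_ge0.
Qed.

Lemma excessE x y : Theta x -> (h x y = eps * pi y + excess x y)%R.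
Proof.
move=> Tx; rewrite /excess.
have /max_idPr -> : (0 <= h x y - eps * pi y)%R.
  by rewrite subr_ge0 minorization.
by rewrite addrC subrK.
Qed.

Let excess_ge0E x y : 0 <= (excess x y)%:E.
Proof. by rewrite lee_fin excess_ge0. Qed.

Let mexcess x : measurable_fun setT (fun y => (excess x y)%:E).
Proof.
apply/measurable_EFinP.
exact: (measurableT_comp measurable_excess (pair1_measurable x)).
Qed.

Lemma integral_excess (f : T -> \bar R) x : Theta x ->
  measurable_fun setT f -> (forall y, 0 <= f y) ->
  \int[mu]_y (f y * (h x y)%:E) =
  eps%:E * \int[Pi]_y f y + \int[mu]_y (f y * (excess x y)%:E).
Proof.
move=> Tx mf f0; rewrite integral_target//.
rewrite -ge0_integralZl//; last 2 first.
- by apply: emeasurable_funM.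
- by move=> y _; rewrite mule_ge0.
rewrite -ge0_integralD//; last 4 first.
- by move=> y _; rewrite !mule_ge0// lee_fin.
- by apply: emeasurable_funM => //; apply: emeasurable_funM.
- by move=> y _; rewrite mule_ge0.
- by apply: emeasurable_funM.
apply: eq_integral => y _.
by rewrite excessE// EFinD ge0_muleDr// ?lee_fin ?mulr_ge0// EFinM muleCA.
Qed.

(** The case [f = 1] of [integral_excess]: from a point of [Theta], removing [eps Pi] takes away
    mass exactly [eps]. *)
Lemma excess_addstay x : Theta x ->
  \int[mu]_y (excess x y)%:E + stay x = (1 - eps)%:E.
Proof.
move=> Tx.
have hE : \int[mu]_y (h x y)%:E = eps%:E + \int[mu]_y (excess x y)%:E.
  transitivity (\int[mu]_y (cst 1 y * (h x y)%:E)).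
    by apply: eq_integral => y _; rewrite mul1e.
  rewrite integral_excess// integral_cst// mul1e.
  rewrite [X in _ * X](_ : _ = 1) ?mule1; last exact: probability_setT.
  by congr (_ + _); apply: eq_integral => y _; rewrite mul1e.
have := h_addstay x; rewrite hE -addeA => /(congr1 (fun u => u - eps%:E)).
by rewrite addeAC subee// add0e EFinB.
Qed.

(** By [excess_addstay], [1 - eps] is a sum of masses, hence nonnegative. *)
Lemma minorization_le1 x : Theta x -> (eps <= 1)%R.
Proof.
move=> Tx; rewrite -subr_ge0 -lee_fin -(excess_addstay Tx).
by rewrite adde_ge0 ?stay_ge0// integral_ge0.
Qed.

Lemma stay_le x : Theta x -> stay x <= (1 - eps)%:E.
Proof.
by move=> Tx; rewrite -(excess_addstay Tx) leeDr// integral_ge0.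
Qed.

(* For [f x = 0] only the moves away from [x] contribute; their total intensity
   is at most [r] times [Pi]. *)
Lemma kpow_le_target t (f : T -> \bar R) (r : R) x :
  measurable_fun setT f -> (forall y, 0 <= f y) -> Theta x -> f x = 0 ->
  (0 <= r)%R -> (forall y, (h x y <= r * pi y)%R) ->
  \int[kpow K t x]_y f y <=
  (r * \sum_(k < t) (1 - eps) ^+ k)%:E * \int[Pi]_y f y.
Proof.
move=> mf f0 Tx fx0 r0 hr; elim: t => [|t IH].
  by rewrite integral_kpow0// fx0 big_ord0 mulr0 mul0e.
pose G y := \int[kpow K t y]_z f z.
have mG : measurable_fun setT G by exact: measurable_integral_kpow.
have G0 y : 0 <= G y by exact: integral_ge0.
have -> : \int[kpow K t.+1 x]_z f z =
    \int[mu]_y (G y * (h x y)%:E) + G x * stay x.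
  by rewrite ge0_integral_kpowS// (integral_jump_stay x mG G0).
(* By invariance [f] and its iterate [G] have the same mean under [Pi], so the moves, with
   [h x <= r pi], contribute at most [r] times the mean of [f]. *)
have PiG : \int[Pi]_y f y = \int[mu]_y (G y * (pi y)%:E).
  by rewrite -(kpow_invariant t mf f0) (integral_target mG G0).
have {}IH : G x <= (r * \sum_(k < t) (1 - eps) ^+ k)%:E * \int[Pi]_y f y by [].
clearbody G.
(* The summand [r] accounts for the moves away from [x], the factor [1 - eps] for staying at [x]. *)
have -> : (r * \sum_(k < t.+1) (1 - eps) ^+ k =
    r + r * (\sum_(k < t) (1 - eps) ^+ k) * (1 - eps))%R.
  rewrite big_ord_recl expr0 mulrDr mulr1 -mulrA mulr_suml; congr (_ + _ * _)%R.
  by apply: eq_bigr => k _; rewrite exprSr.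
rewrite EFinD [leRHS]ge0_muleDl; last 2 first.
- by rewrite lee_fin.
- rewrite lee_fin !mulr_ge0 ?subr_ge0 ?(minorization_le1 Tx)//.
  rewrite sumr_ge0// => k _.
  by rewrite exprn_ge0// subr_ge0 (minorization_le1 Tx).
apply: leeD.
  rewrite PiG -ge0_integralZl//; last 2 first.
  - by apply: emeasurable_funM.
  - by move=> y _; rewrite mule_ge0.
  apply: ge0_le_integral => //.
  - by move=> y _; rewrite mule_ge0.
  - by apply: emeasurable_funM.
  - by apply: emeasurable_funM => //; apply: emeasurable_funM.
  by move=> y _; rewrite muleCA -EFinM lee_wpmul2l// lee_fin.
rewrite EFinM muleAC; apply: lee_pmul => //; first exact: stay_ge0.
exact: stay_le.
Qed.

Variable N : R.-spker T ~> T.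
Hypothesis NE : forall x, N x = jump mu excess stay x :> (set T -> \bar R).

(** Needed at every [x] for the remainder to be a sub-probability kernel; [excess_addstay] covers
    only [Theta]. *)
Lemma excess_stay_le1 x : \int[mu]_y (excess x y)%:E + stay x <= 1.
Proof.
rewrite -[leRHS](h_addstay x) leeD2r//; apply: ge0_le_integral => //.
by move=> y _; rewrite lee_fin excess_le.
Qed.

Lemma integral_excess_jump (f : T -> \bar R) x :
  measurable_fun setT f -> (forall y, 0 <= f y) ->
  \int[N x]_y f y = \int[mu]_y (f y * (excess x y)%:E) + f x * stay x.
Proof.
move=> mf f0; rewrite NE; apply: ge0_integral_jump => //.
- exact: measurable_excess.
- exact: stay_ge0.
- exact: excess_stay_le1.
Qed.

(** Started in [Theta], [N] never leaves it: its jumps vanish outside [Theta] and its atom sits at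
    [x]. Hence a bound on [Theta] suffices, and it is multiplied by the mass [1 - eps]. *)
Lemma integral_excess_jump_le (f : T -> \bar R) (c : R) x :
  measurable_fun setT f -> (forall y, 0 <= f y) -> (0 <= c)%R ->
  (forall y, Theta y -> f y <= c%:E) -> Theta x ->
  \int[N x]_y f y <= ((1 - eps) * c)%:E.
Proof.
move=> mf f0 c0 fc Tx.
rewrite integral_excess_jump// EFinM -(excess_addstay Tx).
rewrite ge0_muleDl ?stay_ge0//; last exact: integral_ge0.
apply: leeD; last by rewrite muleC lee_wpmul2l ?stay_ge0// fc.
rewrite -ge0_integralZr//.
apply: ge0_le_integral => //.
- by move=> y _; rewrite mule_ge0.
- by apply: emeasurable_funM.
- by apply: emeasurable_funM.
move=> y _; rewrite muleC; have [Ty|Ty] := pselect (Theta y).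
  by rewrite lee_wpmul2l// fc.
by rewrite excess_out// !mul0e.
Qed.

Lemma kpow_excess_le t (f : T -> \bar R) (c : R) x :
  measurable_fun setT f -> (forall y, 0 <= f y) -> (0 <= c)%R ->
  (forall y, Theta y -> f y <= c%:E) -> Theta x ->
  \int[kpow N t x]_y f y <= ((1 - eps) ^+ t * c)%:E.
Proof.
move=> mf f0 c0 fc; elim: t x => [|t IH] x Tx.
  by rewrite integral_kpow0// expr0 mul1r fc.
rewrite ge0_integral_kpowS// exprS -mulrA.
apply: integral_excess_jump_le => //.
- exact: measurable_integral_kpow.
- by move=> y; exact: integral_ge0.
- by rewrite mulr_ge0// exprn_ge0// subr_ge0 (minorization_le1 Tx).
Qed.

(* The minorization iterates: each step regenerates from [Pi] with probability
   [eps], and invariance of [Pi] keeps the regenerated part in equilibrium. *)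
Lemma kpow_mixture t x B : Theta x -> measurable B ->
  kpow K t x B = (1 - (1 - eps) ^+ t)%:E * Pi B + kpow N t x B.
Proof.
move=> Tx mB; elim: t x Tx => [|t IH] x Tx.
  by rewrite expr0 subrr mul0e add0e.
have mKt : measurable_fun setT (fun y => kpow K t y B).
  exact: measurable_kernel.
have mNt : measurable_fun setT (fun y => kpow N t y B).
  exact: measurable_kernel.
have Kt0 y : 0 <= kpow K t y B by [].
have Nt0 y : 0 <= kpow N t y B by [].
set c := (1 - (1 - eps) ^+ t)%R in IH *.
have c0 : (0 <= c)%R.
  rewrite subr_ge0 exprn_ile1 ?subr_ge0 ?(minorization_le1 Tx)//.
  by rewrite lerBlDr lerDl.
rewrite [LHS]/= /mkcomp_noparam /kcomp_noparam integral_jump_stay//.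
rewrite integral_excess// kpow_invariantE//.
have -> : \int[mu]_y (kpow K t y B * (excess x y)%:E) =
    c%:E * Pi B * \int[mu]_y (excess x y)%:E +
    \int[mu]_y (kpow N t y B * (excess x y)%:E).
  rewrite -ge0_integralZl//; last by rewrite mule_ge0// lee_fin.
  rewrite -ge0_integralD//; last 4 first.
  - by move=> y _; rewrite !mule_ge0// lee_fin.
  - by apply: emeasurable_funM.
  - by move=> y _; rewrite mule_ge0.
  - by apply: emeasurable_funM.
  (* The induction hypothesis is available on [Theta] only; elsewhere [excess x] vanishes. *)
  apply: eq_integral => y _; have [Ty|Ty] := pselect (Theta y).
    by rewrite IH// ge0_muleDl// mule_ge0// lee_fin.
  by rewrite excess_out// !mule0 adde0.
rewrite IH// [X in _ = _ + X]/= /mkcomp_noparam /kcomp_noparam.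
rewrite integral_excess_jump// ge0_muleDl ?mule_ge0 ?lee_fin//.
(* The two terms in [c * Pi B] combine to the factor [1 - eps], and [eps + (1 - eps) * c] is the
   next coefficient. *)
rewrite -addeA addeACA -ge0_muleDr ?integral_ge0 ?stay_ge0//.
rewrite excess_addstay// addeA; congr (_ + _).
have /fineK <- : Pi B \is a fin_num by exact: fin_num_measure.
by rewrite -!EFinM -EFinD; congr EFin; rewrite /c exprS; ring.
Qed.

End minorization.
End reversible_jump.

(** * The Metropolis-Hastings kernel as a reversible jump kernel *)

Section mhi.
Context (R : realType) (d : nat) (Theta : set 'rV[R]_d).
Context (Pi Q : probability 'rV[R]_d R) (pi q : 'rV[R]_d -> R).
Hypothesis Theta_neq0 : Theta !=set0.
Hypothesis Pi_density : has_density Pi pi.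
Hypothesis Q_density : has_density Q q.
Hypothesis pi_support : has_support pi Theta.
Hypothesis q_support : has_support q Theta.

Local Notation mu := (lebesgue_row R d).

Let h x y := mhi_accept pi q x y * q y.

Let eps := inf [set q theta / pi theta | theta in Theta].

Lemma support_ge0 f : has_support f Theta -> forall x, 0 <= f x.
Proof.
move=> [f0 f_out] x; have [Tx|Tx] := pselect (Theta x); first exact/ltW/f0.
by rewrite f_out.
Qed.

Let pi0 := support_ge0 pi_support.
Let q0 := support_ge0 q_support.

Lemma mhi_accept_ge0 x y : 0 <= mhi_accept pi q x y.
Proof.
rewrite /mhi_accept; case: ifPn => // _.
by rewrite le_min ler01 andbT divr_ge0// mulr_ge0.
Qed.

Lemma mhi_accept_le1 x y : mhi_accept pi q x y <= 1.
Proof.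
by rewrite /mhi_accept; case: ifPn => // _; rewrite ge_min lexx orbT.
Qed.

Let h0 x y : 0 <= h x y.
Proof. by rewrite mulr_ge0// mhi_accept_ge0. Qed.

Let h_le x y : h x y <= q y.
Proof. by rewrite ler_piMl// mhi_accept_le1. Qed.

Let h_out x y : ~ Theta y -> h x y = 0.
Proof. by move=> Ty; rewrite /h q_support.2// mulr0. Qed.

(** For [y] outside [Theta] the acceptance is 1 by convention, but both sides vanish because [pi y]
    and [q y] do. *)
Let hE x y : Theta x -> h x y = Num.min (q x / pi x * pi y) (q y).
Proof.
move=> Tx; have px := pi_support.1 _ Tx.
have [Ty|Ty] := pselect (Theta y); last first.
  by rewrite h_out// (pi_support.2 y)// (q_support.2 y)// mulr0 minxx.
have qy := q_support.1 _ Ty.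
rewrite /h /mhi_accept mulr_gt0// minr_pMl ?(ltW qy)// mul1r; congr Num.min.
by field; rewrite !gt_eqF.
Qed.

(** On [Theta] both sides are the minimum of [q x * pi y] and [pi x * q y]. *)
Let reversible x y : pi x * h x y = pi y * h y x.
Proof.
have [Tx|Tx] := pselect (Theta x); last first.
  by rewrite (pi_support.2 x)// (h_out y Tx) mul0r mulr0.
have [Ty|Ty] := pselect (Theta y); last first.
  by rewrite (pi_support.2 y)// (h_out x Ty) mul0r mulr0.
have px := pi_support.1 _ Tx; have py := pi_support.1 _ Ty.
rewrite !hE// !minr_pMr// minC; congr Num.min.
  by field; rewrite gt_eqF.
by field; rewrite gt_eqF.
Qed.

Let mh : measurable_fun setT (fun z : 'rV[R]_d * 'rV[R]_d => h z.1 z.2).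
Proof.
have [mpi _] := Pi_density; have [mq _] := Q_density.
have mf1 f : measurable_fun setT f ->
    measurable_fun setT (fun z : 'rV[R]_d * 'rV[R]_d => f z.1 : R).
  by move=> mf; exact: (measurableT_comp mf measurable_fst).
have mf2 f : measurable_fun setT f ->
    measurable_fun setT (fun z : 'rV[R]_d * 'rV[R]_d => f z.2 : R).
  by move=> mf; exact: (measurableT_comp mf measurable_snd).
have mden : measurable_fun setT
    (fun z : 'rV[R]_d * 'rV[R]_d => pi z.1 * q z.2).
  by apply: measurable_funM; [exact: mf1|exact: mf2].
apply: measurable_funM; last exact: mf2.
apply: measurable_fun_ifT => //; first exact: measurable_fun_ltr.
apply: measurable_minr => //; apply: measurable_funM.
  by apply: measurable_funM; [exact: mf2|exact: mf1].
(* The inverse of a nonnegative real, 0 included, is its real power of exponent -1, a measurable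
   function. *)
under eq_fun do rewrite -powR_inv1 ?mulr_ge0//.
exact: (measurableT_comp (measurable_powR (-1)) mden).
Qed.

Let h_le1 x : (\int[mu]_y (h x y)%:E <= 1)%E.
Proof.
have [mq QE] := Q_density.
rewrite -(@probability_setT _ _ _ Q) QE//; apply: ge0_le_integral => //.
- by move=> y _; rewrite lee_fin.
- by apply/measurable_EFinP; exact: (measurableT_comp mh (pair1_measurable x)).
- exact/measurable_EFinP.
- by move=> y _; rewrite lee_fin.
Qed.

Let ratio_lb : has_lbound [set q theta / pi theta | theta in Theta].
Proof. by exists 0 => _ [x _ <-]; rewrite divr_ge0. Qed.

Let eps0 : 0 <= eps.
Proof.
apply: lb_le_inf; first by case: Theta_neq0 => x Tx; exists (q x / pi x), x.
by move=> _ [x _ <-]; rewrite divr_ge0.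
Qed.

Let eps_le x : Theta x -> eps <= q x / pi x.
Proof. by move=> Tx; apply: ge_inf => //; exists x. Qed.

(** Of the two branches of the minimum in [hE], the first is bounded below by the ratio at [x], the
    second by the ratio at [y]. *)
Let minorization x y : Theta x -> eps * pi y <= h x y.
Proof.
move=> Tx; rewrite hE// le_min ler_wpM2r ?eps_le//=.
have [Ty|Ty] := pselect (Theta y).
  by rewrite -ler_pdivlMr ?eps_le// pi_support.1.
by rewrite (pi_support.2 y)// (q_support.2 y)// mulr0.
Qed.

Let stay0 := @stay_ge0 _ _ R mu h h_le1.

Let mstay := @measurable_stay _ _ R mu h h0 mh.

Let h_stay := @h_addstay _ _ R mu h h0 h_le1.

Let mpi : measurable_fun setT pi := Pi_density.1.

Let PiE := Pi_density.2.

Let eps1 : eps <= 1.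
Proof.
have [x Tx] := Theta_neq0.
exact: (minorization_le1 h0 mh h_le1 pi0 mpi PiE eps0 minorization Tx).
Qed.

Let ratio_ge x y : Theta x -> h x y <= q x / pi x * pi y.
Proof. by move=> Tx; rewrite hE// ge_min lexx. Qed.

Let mhi_kernel_jump : exists K : R.-spker 'rV[R]_d ~> 'rV[R]_d,
  forall x, K x = mhi_kernel pi q x :> (set 'rV[R]_d -> \bar R).
Proof.
apply: (jump_kernel h0 mh stay0 mstay) => x.
by rewrite h_stay.
Qed.

(** * Convergence bounds for the sampler in Wasserstein distance *)

Section metric.
Variable rho : 'rV[R]_d -> 'rV[R]_d -> R.
Hypothesis rho_metric : is_metric rho.
Hypothesis rho_lsc : lower_semicontinuous
  (fun z : 'rV[R]_d * 'rV[R]_d => (rho z.1 z.2)%:E).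
Hypothesis rho_le1 : forall x y, rho x y <= 1.

Let rho0 := is_metric_ge0 rho_metric.

Let rhoE0 x y : (0 <= (rho x y)%:E)%E. Proof. by rewrite lee_fin. Qed.

Let mrho := lower_semicontinuous_measurable_row2 rho_lsc.

Let F theta : \bar R := (\int[Pi]_omega (rho omega theta)%:E)%E.

Let mrhol x : measurable_fun setT (fun y => (rho y x)%:E).
Proof. exact: (measurableT_comp mrho (pair2_measurable x)). Qed.

Let F0 x : (0 <= F x)%E. Proof. exact: integral_ge0. Qed.

Let F1 x : (F x <= 1)%E.
Proof.
rewrite -[leRHS](@probability_setT _ _ _ Pi) -[leRHS]mul1e -integral_cst//.
by apply: ge0_le_integral => // y _; rewrite lee_fin.
Qed.

Let F_fin x : F x \is a fin_num.
Proof. by rewrite ge0_fin_numE// (le_lt_trans (F1 x))// ltry. Qed.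

Let mF : measurable_fun setT F.
Proof.
exact: (measurable_fun_fubini_tonelli_G (m1 := Pi) (fun z => (rho z.1 z.2)%:E)).
Qed.

(** The coupling costs the integral of [F] against the [t]-th iterate of [N], which lives on [Theta]
    when started there; so the supremum over [Theta] bounds the integrand. *)
Lemma wasserstein_mhi_le t x : Theta x ->
  (wasserstein rho (kernel_iter (mhi_kernel pi q) t x) Pi <=
   ((1 - eps) ^+ t)%:E * ereal_sup [set F theta | theta in Theta])%E.
Proof.
move=> Tx; set S := ereal_sup _.
have [K KE] := mhi_kernel_jump.
have [N NE] := jump_kernel (excess_ge0 h pi eps) (measurable_excess mh mpi eps)
  stay0 mstay (excess_stay_le1 h0 mh h_le1 pi0 mpi eps0).
have FS y : Theta y -> (F y <= S)%E.
  by move=> Ty; apply: ereal_sup_ubound; exists y.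
have S_fin : S \is a fin_num.
  (* As [rho <= 1], the supremum is a real number and can serve as the constant in
     [kpow_excess_le]. *)
  rewrite ge0_fin_numE; last exact: le_trans (FS _ Tx).
  rewrite (le_lt_trans _ (ltry 1))//; apply: ge_ereal_sup => _ [y _ <-].
  exact: F1.
pose M : {finite_measure set 'rV[R]_d -> \bar R} :=
  finite_of_measure (finite_kernel_measure (kpow N t) x).
have c0 : 0 <= 1 - (1 - eps) ^+ t.
  by rewrite subr_ge0 exprn_ile1 ?subr_ge0// lerBlDr lerDl.
apply: (@le_trans _ _ (\int[M]_y \int[Pi]_omega (rho y omega)%:E)%E).
  apply: (wasserstein_le_mixture rho0 mrho _ c0).
  - by move=> y; apply/(is_metric_eq0 rho_metric).
  - move=> A mA; rewrite (kernel_iterE _ _ KE mA).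
    exact: (kpow_mixture h0 mh h_le1 pi0 mpi PiE KE reversible eps0 minorization
      h_out NE t Tx mA).
  - by rewrite (kernel_iterE _ _ KE measurableT) (kpow_setT h0 h_le1 KE).
rewrite -(fineK S_fin) -EFinM.
rewrite (_ : (\int[M]_y _)%E = (\int[kpow N t x]_y F y)%E); last first.
  apply: eq_integral => y _; apply: eq_integral => w _.
  by rewrite (is_metric_sym rho_metric).
apply: (kpow_excess_le h0 mh h_le1 pi0 mpi PiE eps0 minorization h_out NE)
  => //.
- by rewrite fine_ge0// (le_trans _ (FS _ Tx)).
- by move=> y Ty; rewrite fineK// FS.
Qed.

(** With [r] the ratio at [x] and [S] the geometric sum, the potential gives the factor [1 - r S],
    that is [(1 - eps)^t - (r - eps) S]; the crude bound [S <= t] yields the stated loss. *)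
Lemma wasserstein_mhi_ge t x : Theta x ->
  (((1 - eps) ^+ t - (q x / pi x - eps) * t%:R)%:E * F x <=
   wasserstein rho (kernel_iter (mhi_kernel pi q) t x) Pi)%E.
Proof.
move=> Tx; have [K KE] := mhi_kernel_jump.
set r := q x / pi x; set S := \sum_(k < t) (1 - eps) ^+ k.
have r0 : 0 <= r by rewrite divr_ge0.
have rhoxx := congr1 EFin ((is_metric_eq0 rho_metric x x).2 erefl).
have KF := kpow_le_target h0 mh h_le1 pi0 mpi PiE KE reversible eps0
  minorization t (mrhol x) (rhoE0^~ x) Tx rhoxx r0 (fun y => ratio_ge y Tx).
have PiF : (\int[Pi]_y (rho y x)%:E = (fine (F x))%:E)%E by rewrite fineK.
rewrite PiF -EFinM in KF.
have := wasserstein_ge_potential rho0 mrho Pi (is_metric_sym rho_metric)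
  (is_metric_triangle rho_metric) (fun A mA => kernel_iterE t x KE mA) KF.
apply: le_trans; rewrite PiF -(fineK (F_fin x)) -EFinM -EFinB lee_fin.
have f0 : 0 <= fine (F x) by rewrite fine_ge0.
(* The geometric sum in product form, valid for [eps = 0] too. *)
have epsS : eps * S = 1 - (1 - eps) ^+ t.
  by apply: oppr_inj; rewrite opprB subrX1 -/S; ring.
have St : S <= t%:R.
  rewrite -[t in leRHS]card_ord -sum1_card natr_sum; apply: ler_sum => k _.
  by rewrite exprn_ile1 ?subr_ge0// lerBlDr lerDl.
have -> : (1 - eps) ^+ t = 1 - eps * S by rewrite epsS; ring.
rewrite -subr_ge0.
have -> : fine (F x) - r * S * fine (F x) -
    (1 - eps * S - (r - eps) * t%:R) * fine (F x) =
    (r - eps) * (t%:R - S) * fine (F x) by ring.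
by rewrite !mulr_ge0// subr_ge0// eps_le.
Qed.

Let Wsup t : \bar R := ereal_sup
  [set wasserstein rho (kernel_iter (mhi_kernel pi q) t theta) Pi
  | theta in Theta].

Lemma mhi_upper_bound t :
  (Wsup t <= ((1 - eps) ^+ t)%:E * ereal_sup [set F theta | theta in Theta])%E.
Proof. by apply: ge_ereal_sup => _ [x Tx <-]; exact: wasserstein_mhi_le. Qed.

Lemma mhi_lower_bound t :
  (((1 - eps) ^+ t)%:E * ereal_inf [set F theta | theta in Theta] <= Wsup t)%E.
Proof.
set m := ereal_inf _; have [x0 Tx0] := Theta_neq0.
have m0 : (0 <= m)%E by apply: le_ereal_inf_tmp => _ [x _ <-].
have m_le x : Theta x -> (m <= F x)%E.
  by move=> Tx; apply: ereal_inf_lbound; exists x.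
have m_fin : m \is a fin_num.
  by rewrite ge0_fin_numE// (le_lt_trans (m_le _ Tx0))// -ge0_fin_numE.
apply/lee_addgt0Pr => e e0.
(* The tolerance makes the loss [(r - eps) * t] at most [e]; dividing by [t + 1] covers [t = 0]. *)
have [x Tx xe] : exists2 x, Theta x & q x / pi x < eps + e / t.+1%:R.
  have et : 0 < e / t.+1%:R by rewrite divr_gt0.
  have [|_ [x Tx <-] xe] :=
      inf_adherent et (E := [set q y / pi y | y in Theta]).
    by split=> //; exists (q x0 / pi x0), x0.
  by exists x.
have WF : (((1 - eps) ^+ t - (q x / pi x - eps) * t%:R)%:E * F x <= Wsup t)%E.
  apply: le_trans; last by apply: ereal_sup_ubound; exists x.
  exact: wasserstein_mhi_ge.
apply: le_trans (leeD2r _ WF).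
have := m_le x Tx; have := F0 x; have := F1 x.
rewrite -(fineK m_fin) -(fineK (F_fin x)) -!EFinM -EFinD !lee_fin.
have := eps_le Tx; set f := fine (F x); set p := (1 - eps) ^+ t.
set r := q x / pi x in xe *; move=> er f1 f0 mf.
have p0 : 0 <= p by rewrite exprn_ge0// subr_ge0.
have : (r - eps) * t%:R <= e.
  rewrite (@le_trans _ _ (e / t.+1%:R * t.+1%:R))//; last by rewrite divfK.
  by rewrite ler_pM// ?subr_ge0// ?ler_nat// lerBlDl ltW.
have : 0 <= (r - eps) * t%:R by rewrite mulr_ge0// subr_ge0.
have : 0 <= p * (f - fine m) by rewrite mulr_ge0// subr_ge0.
(* With [L] the loss, [p * m <= p * f = (p - L) * f + L * f], and [L * f <= e] because [f <= 1];
   here [m] is read as a real. *)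
nra.
Qed.

End metric.
End mhi.

Unset Implicit Arguments.
Set Strict Implicit.

Theorem theorem1 (R : realType) (d : nat) (Theta : set 'rV[R]_d)
    (Pi Q : probability 'rV[R]_d R) (pi q : 'rV[R]_d -> R)
    (rho : 'rV[R]_d -> 'rV[R]_d -> R)
    (Theta_neq0 : Theta !=set0)
    (mTheta : measurable Theta)
    (Q_neq_Pi : ~ (forall A : set 'rV[R]_d, measurable A -> Q A = Pi A))
    (Pi_density : has_density Pi pi)
    (Q_density : has_density Q q)
    (pi_support : has_support pi Theta)
    (q_support : has_support q Theta)
    (rho_metric : is_metric rho)
    (rho_lsc : lower_semicontinuous
      (fun z : ('rV[R]_d * 'rV[R]_d)%type => (rho z.1 z.2)%:E))
    (rho_le1 : forall x y, rho x y <= 1) :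
  let eps : R := inf [set q theta / pi theta | theta in Theta] in
  let Wsup (t : nat) : \bar R :=
    ereal_sup [set wasserstein rho (kernel_iter (mhi_kernel pi q) t theta) Pi
              | theta in Theta] in
  (forall t : nat, (0 < t)%N ->
    (Wsup t <=
      ((1 - eps) ^+ t)%:E *
      ereal_sup [set \int[Pi]_omega (rho omega theta)%:E
                | theta in Theta])%E) /\
  (lower_semicontinuous (fun x : subspace Theta => (q x)%:E) ->
   upper_semicontinuous (fun x : subspace Theta => (pi x)%:E) ->
   (exists K : nat -> set 'rV[R]_d,
     (forall n, compact (K n)) /\ Theta = \bigcup_n K n) ->
   forall t : nat, (0 < t)%N ->
    (((1 - eps) ^+ t)%:E *
      ereal_inf [set \int[Pi]_omega (rho omega theta)%:E
                | theta in Theta] <= Wsup t)%E /\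
    (Wsup t <=
      ((1 - eps) ^+ t)%:E *
      ereal_sup [set \int[Pi]_omega (rho omega theta)%:E
                | theta in Theta])%E).
Proof.
have upper := mhi_upper_bound Theta_neq0 Pi_density Q_density pi_support
  q_support rho_metric rho_lsc rho_le1.
have lower := mhi_lower_bound Theta_neq0 Pi_density Q_density pi_support
  q_support rho_metric rho_lsc rho_le1.
by split=> [t _|_ _ _ t _]; [exact: upper|split; [exact: lower|exact: upper]].
Qed.
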